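(* Let $n\ge 1$, let $\mathbf R=(R_1,\dots,R_{n-1})$ be any family of subsets of $\{1,\dots,n+1\}$, and let $S$ be an $\mathbf R$-admissible sequence with associated fixed point $p_S$ and subrepresentation $M_S\subset M^{\mathbf R}$. Then $$|\mathrm{Sing}(p_S)|=\dim \mathrm{Ext}^1(M_S, M^{\mathbf R}/M_S).$$
   Context: Fix a basis $v_1,\dots,v_{n+1}$ of $\mathbb C^{n+1}$. For $R\subset\{1,\dots,n+1\}$ let $\pi_R:\mathbb C^{n+1}\to\mathbb C^{n+1}$ be the linear map with $\pi_R(v_k)=0$ if $k\in R$ and $\pi_R(v_k)=v_k$ otherwise. $M^{\mathbf R}$ is the representation $\mathbb C^{n+1}\xrightarrow{\pi_{R_1}}\cdots\xrightarrow{\pi_{R_{n-1}}}\mathbb C^{n+1}$ over $\mathbb C$ of the equioriented quiver of type $A_n$ ($n$ vertices $1\to2\to\cdots\to n$). $\mathrm{Ext}^1$ is taken in the category of representations of this quiver. An $\mathbf R$-admissible sequence is a family $S=(S_1,\dots,S_n)$ of subsets of $\{1,\dots,n+1\}$ with $|S_i|=i$ for $1\le i\le n$ and $S_i\subset S_{i+1}\cup R_i$ for $1\le i\le n-1$. $M_S$ is the subrepresentation of $M^{\mathbf R}$ with $(M_S)_i=\mathrm{span}\{v_k:k\in S_i\}$, and $p_S$ is the corresponding point of the quiver Grassmannian of subrepresentations of $M^{\mathbf R}$ of dimension vector $(1,\dots,n)$. Coefficient quiver. $Q(M^{\mathbf R})$ has vertices $v_k^i$ ($1\le k\le n+1$ the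 row, $1\le i\le n$ the column), and an arrow $v_k^i\to v_k^{i+1}$ for each $1\le i\le n-1$ with $k\notin R_i$. $Q_S$ is the full subquiver on the vertices $v_k^i$ with $k\in S_i$. Singularity set. Put $\mathrm{pos}(i)=\{j\in\{1,\dots,n-1\}: i\in R_j\}$ for $1\le i\le n+1$. $\mathrm{Sing}_i(p_S)$ is the set of pairs $(j,h+1)$ with $j\in\{1,\dots,n+1\}$, $h\in\mathrm{pos}(i)$ and $j\notin S_{h+1}$, such that there exists $k\in\mathrm{pos}(j)$ with $k\le h$, $i\in S_t$ for all $k\le t\le h$, and the segment spanned by $v_i^k,\dots,v_i^h$ connected in $Q_S$. $\mathrm{Sing}(p_S)$ is the disjoint union $\bigsqcup_{i=1}^{n+1}\mathrm{Sing}_i(p_S)$. *)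

(* Defs.v *)
From HB Require Import structures.
From mathcomp Require Import all_boot all_order all_algebra.

Set Implicit Arguments.
Unset Strict Implicit.
Unset Printing Implicit Defensive.

Import GRing.Theory.
Local Open Scope ring_scope.

Lemma linfun_linearE (F : fieldType) (V W : vectType F) (f : V -> W) :
  linear f -> linfun f =1 f.
Proof.
move=> lf x.
pose fL : {linear V -> W} :=
  HB.pack f (GRing.isLinear.Build F V W *:%R f lf).
exact: (lfunE fL x).
Qed.

Section LinearMaps.
Variable F : fieldType.
Implicit Types V W : vectType F.

Definition prod_lfun V W V' W' (f : 'Hom(V, W)) (g : 'Hom(V', W')) :
  'Hom((V * V')%type, (W * W')%type) := linfun (fun u => (f u.1, g u.2)).

Definition diag_lfun V : 'Hom(V, (V * V)%type) := linfun (fun u => (u, u)).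

Definition codiag_lfun V : 'Hom((V * V)%type, V) :=
  linfun (fun u : V * V => u.1 + u.2).

Definition incl_lfun V (U : {vspace V}) : 'Hom(subvs_of U, V) := linfun vsval.

(* The quotient space V / U is modelled by the complement U^C of U; quo_lfun is
   the projection V -> V / U, that is, the projection onto U^C along U. *)
Definition quo_lfun V (U : {vspace V}) : 'Hom(V, subvs_of U^C) :=
  linfun (fun v => vsproj U^C (daddv_pi U^C U v)).

Lemma prod_lfunE V W V' W' (f : 'Hom(V, W)) (g : 'Hom(V', W')) u :
  prod_lfun f g u = (f u.1, g u.2).
Proof.
by rewrite linfun_linearE // => a x y; rewrite /= !linearP.
Qed.

Lemma diag_lfunE V u : diag_lfun V u = (u, u).
Proof. by rewrite linfun_linearE. Qed.

Lemma codiag_lfunE V u : codiag_lfun V u = u.1 + u.2.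
Proof.
by rewrite linfun_linearE // => a x y; rewrite /= scalerDr addrACA.
Qed.

Lemma incl_lfunE V (U : {vspace V}) u : incl_lfun U u = vsval u.
Proof. by rewrite lfunE. Qed.

Lemma quo_lfunE V (U : {vspace V}) v :
  vsval (quo_lfun U v) = daddv_pi U^C U v.
Proof.
rewrite linfun_linearE; last by move=> a x y; rewrite !linearP.
by rewrite vsprojK // memv_pi.
Qed.

Lemma capCv V (U : {vspace V}) : (U^C :&: U = 0)%VS.
Proof. by rewrite capvC capv_compl. Qed.

Lemma lker_incl V (U : {vspace V}) : lker (incl_lfun U) = 0%VS.
Proof.
by apply/eqP/lker0P => u v; rewrite !incl_lfunE; apply: val_inj.
Qed.

Lemma limg_incl V (U : {vspace V}) : limg (incl_lfun U) = U.
Proof.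
apply/vspaceP => v; apply/memv_imgP/idP => [[u _ ->]|vU].
  by rewrite incl_lfunE subvsP.
by exists (vsproj U v); rewrite ?memvf // incl_lfunE vsprojK.
Qed.

Lemma lker_quo V (U : {vspace V}) : lker (quo_lfun U) = U.
Proof.
apply/vspaceP => v; rewrite memv_ker -(inj_eq val_inj) /= quo_lfunE.
have dV : v = daddv_pi U^C U v + daddv_pi U U^C v.
  by rewrite daddv_pi_add ?capCv // addvC addv_complf memvf.
apply/eqP/idP => [v0|vU].
  by rewrite dV v0 add0r memv_pi.
have: v = daddv_pi U U^C v by rewrite daddv_pi_id ?capv_compl.
by move=> vE; move: dV; rewrite -vE -{1}[v]add0r => /addIr.
Qed.

Lemma limg_quo V (U : {vspace V}) : limg (quo_lfun U) = fullv.
Proof.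
apply/vspaceP => w; rewrite memvf; apply/memv_imgP.
exists (vsval w); rewrite ?memvf //; apply: val_inj.
by rewrite /= quo_lfunE daddv_pi_id ?capCv ?subvsP.
Qed.

End LinearMaps.

Record quiver := Quiver {
  vertex : finType;
  arrow : finType;
  src : arrow -> vertex;
  tgt : arrow -> vertex }.

Record rep (F : fieldType) (Q : quiver) := Rep {
  rep_space :> vertex Q -> vectType F;
  rep_map : forall a : arrow Q, 'Hom(rep_space (src a), rep_space (tgt a)) }.

Record rep_hom (F : fieldType) (Q : quiver) (M N : rep F Q) := RepHom {
  rep_hom_map :> forall x : vertex Q, 'Hom(M x, N x);
  rep_hom_comm : forall a : arrow Q,
    (rep_map N a \o rep_hom_map (src a) =
     rep_hom_map (tgt a) \o rep_map M a)%VF }.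

Record subrep (F : fieldType) (Q : quiver) (M : rep F Q) := Subrep {
  sub_space :> forall x : vertex Q, {vspace M x};
  sub_stable : forall a : arrow Q,
    (rep_map M a @: sub_space (src a) <= sub_space (tgt a))%VS }.

Section Representations.
Variables (F : fieldType) (Q : quiver).
Implicit Types M N : rep F Q.

Definition id_hom M : rep_hom M M.
Proof. by exists (fun x => \1%VF) => a; rewrite comp_lfun1l comp_lfun1r. Defined.

Definition scale_hom (c : F) M : rep_hom M M.
Proof.
exists (fun x => c *: \1%VF) => a.
by rewrite -comp_lfunZl -comp_lfunZr comp_lfun1l comp_lfun1r.
Defined.

Definition rep_sum M N : rep F Q :=
  Rep (rep_space := fun x => (M x * N x)%type)
      (fun a => prod_lfun (rep_map M a) (rep_map N a)).

Definition diag_hom M : rep_hom M (rep_sum M M).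
Proof.
exists (fun x => diag_lfun (M x)) => a; apply/lfunP => u.
by rewrite !comp_lfunE prod_lfunE !diag_lfunE.
Defined.

Definition codiag_hom M : rep_hom (rep_sum M M) M.
Proof.
exists (fun x => codiag_lfun (M x)) => a; apply/lfunP => u.
by rewrite !comp_lfunE !codiag_lfunE prod_lfunE linearD.
Defined.

Definition sum_hom M N M' N' (f : rep_hom M N) (g : rep_hom M' N') :
  rep_hom (rep_sum M M') (rep_sum N N').
Proof.
exists (fun x => prod_lfun (f x) (g x)) => a; apply/lfunP => u.
rewrite !comp_lfunE !prod_lfunE /=.
by rewrite -!comp_lfunE !rep_hom_comm.
Defined.

Definition rep_sub M (U : subrep M) : rep F Q :=
  Rep (rep_space := fun x => subvs_of (U x))
      (fun a => linfun (fun u => vsproj (U (tgt a)) (rep_map M a (vsval u)))).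

Definition rep_quo M (U : subrep M) : rep F Q :=
  Rep (rep_space := fun x => subvs_of (U x)^C)
      (fun a => (quo_lfun (U (tgt a)) \o rep_map M a
                 \o incl_lfun (U (src a))^C)%VF).

Definition sub_hom M (U : subrep M) : rep_hom (rep_sub U) M.
Proof.
exists (fun x => incl_lfun (U x)) => a; apply/lfunP => u.
rewrite !comp_lfunE !incl_lfunE linfun_linearE => [|c x y].
  by rewrite vsprojK // (subvP (sub_stable U a)) // memv_img // subvsP.
by rewrite !linearP.
Defined.

Definition quo_hom M (U : subrep M) : rep_hom M (rep_quo U).
Proof.
exists (fun x => quo_lfun (U x)) => a; apply/lfunP => u.
rewrite /= !comp_lfunE incl_lfunE quo_lfunE.
set w := daddv_pi _ _ u.
have uE : u = w + daddv_pi (U (src a)) (U (src a))^C u.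
  by rewrite daddv_pi_add ?capCv // addvC addv_complf memvf.
rewrite [in RHS]uE !linearD /=.
have /eqP-> : quo_lfun (U (tgt a))
    (rep_map M a (daddv_pi (U (src a)) (U (src a))^C u)) == 0.
  by rewrite -memv_ker lker_quo (subvP (sub_stable U a)) // memv_img // memv_pi.
by rewrite addr0.
Defined.

(* A short exact sequence 0 -> N -> E -> M -> 0. *)
Record extension M N := Extension {
  ext_mid : rep F Q;
  ext_inj : rep_hom N ext_mid;
  ext_surj : rep_hom ext_mid M;
  ext_inj_ker : forall x, lker (ext_inj x) = 0%VS;
  ext_exact : forall x, limg (ext_inj x) = lker (ext_surj x);
  ext_surj_img : forall x, limg (ext_surj x) = fullv }.

(* 0 -> U -> M -> M / U -> 0 *)
Definition sub_extension M (U : subrep M) : extension (rep_quo U) (rep_sub U).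
Proof.
apply: (@Extension _ _ M (sub_hom U) (quo_hom U)) => x /=.
- exact: lker_incl.
- by rewrite limg_incl lker_quo.
- exact: limg_quo.
Defined.

Definition sum_extension M N M' N' (E : extension M N) (E' : extension M' N') :
  extension (rep_sum M M') (rep_sum N N').
Proof.
apply: (@Extension _ _ (rep_sum (ext_mid E) (ext_mid E'))
  (sum_hom (ext_inj E) (ext_inj E')) (sum_hom (ext_surj E) (ext_surj E')))
  => x /=.
- apply/eqP/lker0P => -[u1 u2] [w1 w2]; rewrite !prod_lfunE /=.
  have /eqP/lker0P inj1 := ext_inj_ker E x.
  have /eqP/lker0P inj2 := ext_inj_ker E' x.
  by case=> /inj1 -> /inj2 ->.
- apply/vspaceP => -[u1 u2]; rewrite memv_ker prod_lfunE /=.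
  apply/memv_imgP/eqP => [[w _]|[/eqP u1K /eqP u2K]].
    rewrite prod_lfunE => -[-> ->]; congr pair; apply/eqP;
    by rewrite -memv_ker -ext_exact memv_img ?memvf.
  move: u1K u2K; rewrite -!memv_ker -!ext_exact.
  move=> /memv_imgP[w1 _ ->] /memv_imgP[w2 _ ->].
  by exists (w1, w2); rewrite ?memvf // prod_lfunE.
- apply/vspaceP => -[u1 u2]; rewrite memvf; apply/memv_imgP.
  have /memv_imgP[w1 _ ->] : u1 \in limg (ext_surj E x).
    by rewrite ext_surj_img memvf.
  have /memv_imgP[w2 _ ->] : u2 \in limg (ext_surj E' x).
    by rewrite ext_surj_img memvf.
  by exists (w1, w2); rewrite ?memvf // prod_lfunE.
Defined.

(* There is a commutative diagram
     0 -> N  -> E  -> M  -> 0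
          |f    |     |g
     0 -> N' -> E' -> M' -> 0
   For g = id it says that E' is the pushout of E along f; for f = id it says
   that E is the pullback of E' along g. *)
Definition ext_over M N M' N' (f : rep_hom N N') (g : rep_hom M M')
    (E : extension M N) (E' : extension M' N') : Prop :=
  exists h : rep_hom (ext_mid E) (ext_mid E'), forall x,
    (h x \o ext_inj E x = ext_inj E' x \o f x)%VF /\
    (ext_surj E' x \o h x = g x \o ext_surj E x)%VF.

Definition ext_equiv M N (E E' : extension M N) : Prop :=
  ext_over (id_hom N) (id_hom M) E E'.

(* E is a representative of the class c [E1]. *)
Definition is_ext_scale M N (c : F) (E1 E : extension M N) : Prop :=
  ext_over (scale_hom c N) (id_hom M) E1 E.

(* E is a representative of the Baer sum [E1] + [E2]: with P the pullback of
   E1 (+) E2 along the diagonal of M, E is the pushout of P along the codiagonal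
   of N. *)
Definition is_baer_sum M N (E1 E2 E : extension M N) : Prop :=
  exists P : extension M (rep_sum N N),
    ext_over (id_hom (rep_sum N N)) (diag_hom M) P (sum_extension E1 E2) /\
    ext_over (codiag_hom N) (id_hom M) P E.

(* dim Ext^1(M, N) = d: equivalence classes of extensions, with the Baer sum and
   the scaling above, form a vector space isomorphic to F^d via phi. *)
Definition dim_Ext1 M N (d : nat) : Prop :=
  exists phi : extension M N -> 'rV[F]_d,
    [/\ forall E E', phi E = phi E' <-> ext_equiv E E',
        forall w, exists E, phi E = w,
        forall E1 E2 E, phi E = phi E1 + phi E2 <-> is_baer_sum E1 E2 E
      & forall c E1 E, phi E = c *: phi E1 <-> is_ext_scale c E1 E].

End Representations.

(* Vertices (columns) are numbered 0, ..., n.-1 instead of 1, ..., n, and rows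
   0, ..., n instead of 1, ..., n.+1; the arrow a : 'I_n.-1 goes from the vertex a to
   the vertex a.+1, so R a is the set labelled R_(a+1) in 1-based notation. *)
Definition An_src n (a : 'I_n.-1) : 'I_n := widen_ord (leq_pred n) a.

Lemma An_tgt_proof n (a : 'I_n.-1) : (a.+1 < n)%N.
Proof. by rewrite -ltn_predRL. Qed.

Definition An_tgt n (a : 'I_n.-1) : 'I_n := Ordinal (An_tgt_proof a).

Definition An n : quiver := Quiver (@An_src n) (@An_tgt n).

Section Projections.
Variables (F : fieldType) (n : nat) (v : n.+1.-tuple 'rV[F]_n.+1).

Definition proj_R (A : {set 'I_n.+1}) : 'End('rV[F]_n.+1) :=
  linfun (fun x => \sum_(k | k \notin A) coord v k x *: v`_k).

Definition MR (R : 'I_n.-1 -> {set 'I_n.+1}) : rep F (An n) :=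
  @Rep F (An n) (fun=> 'rV[F]_n.+1) (fun a => proj_R (R a)).

Definition span_rows (A : {set 'I_n.+1}) : {vspace 'rV[F]_n.+1} :=
  <<[seq v`_(val k) : 'rV[F]_n.+1 | k <- enum A]>>%VS.

Lemma proj_RE (A : {set 'I_n.+1}) (k : 'I_n.+1) : basis_of fullv v ->
  proj_R A v`_k = if k \in A then 0 else v`_k.
Proof.
move=> /basis_free vfree; rewrite linfun_linearE; last first.
  move=> c x y; rewrite scaler_sumr -big_split /=; apply: eq_bigr => i _.
  by rewrite linearP scalerDl scalerA.
under eq_bigr => i _ do rewrite coord_free //.
have [kA|kA] := ifPn.
  apply: big1 => i iA; case: eqP => [ik|_]; last by rewrite scale0r.
  by rewrite -ik kA in iA.
rewrite (bigD1 k) //= eqxx scale1r big1 ?addr0 // => i /andP[_ ik].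
by rewrite eq_sym (negPf ik) scale0r.
Qed.

End Projections.

Definition admissible n (R : 'I_n.-1 -> {set 'I_n.+1})
    (S : 'I_n -> {set 'I_n.+1}) : Prop :=
  (forall i : 'I_n, #|S i| = i.+1) /\
  (forall a : 'I_n.-1, S (An_src a) \subset S (An_tgt a) :|: R a).

Lemma MS_stable (F : fieldType) n (v : n.+1.-tuple 'rV[F]_n.+1)
    (R : 'I_n.-1 -> {set 'I_n.+1}) (S : 'I_n -> {set 'I_n.+1}) :
  basis_of fullv v -> admissible R S -> forall a : arrow (An n),
  (rep_map (MR v R) a @: span_rows v (S (src a)) <= span_rows v (S (tgt a)))%VS.
Proof.
move=> vB [_ SR] a; rewrite /span_rows limg_span; apply/span_subvP => w.
move=> /mapP[_ /mapP[k kS ->] ->]; rewrite mem_enum in kS.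
rewrite /= proj_RE //; case: ifPn => [_|kR]; first exact: mem0v.
apply/memv_span/mapP; exists k => //; rewrite mem_enum.
by have := subsetP (SR a) _ kS; rewrite inE (negPf kR) orbF.
Qed.

Definition MS (F : fieldType) n (v : n.+1.-tuple 'rV[F]_n.+1)
    (R : 'I_n.-1 -> {set 'I_n.+1}) (S : 'I_n -> {set 'I_n.+1})
    (vB : basis_of fullv v) (adm : admissible R S) : subrep (MR v R) :=
  @Subrep F (An n) (MR v R) (fun i => span_rows v (S i)) (MS_stable vB adm).

(* p_S lies in the Grassmannian for the dimension vector (1, ..., n). *)
Lemma dim_MS (F : fieldType) n (v : n.+1.-tuple 'rV[F]_n.+1)
    (R : 'I_n.-1 -> {set 'I_n.+1}) (S : 'I_n -> {set 'I_n.+1})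
    (vB : basis_of fullv v) (adm : admissible R S) (i : 'I_n) :
  \dim (MS vB adm i) = i.+1.
Proof.
have vfree := basis_free vB.
have v_inj : {in enum (S i) &, injective (fun k : 'I_n.+1 => v`_k)}.
  move=> k l _ _ /eqP; rewrite nth_uniq ?size_tuple ?free_uniq //.
  by move=> /eqP/val_inj.
rewrite /= /span_rows (eqnP (_ : free _)) ?size_map -?cardE ?adm.1 //.
set X := map _ _.
have sXv : {subset X <= v}.
  by move=> _ /mapP[k _ ->]; rewrite mem_nth // size_tuple ltn_ord.
rewrite (@perm_free _ _ _ [seq x <- v | x \in X]) ?filter_free //.
apply: uniq_perm.
- by rewrite /X map_inj_in_uniq ?enum_uniq.
- by rewrite filter_uniq ?free_uniq.
- by move=> x; rewrite mem_filter andb_idr //; apply: sXv.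
Qed.

Section Singularities.
Variables (n : nat) (R : 'I_n.-1 -> {set 'I_n.+1}) (S : 'I_n -> {set 'I_n.+1}).

(* The vertex v_k^i of the coefficient quiver is the pair (k, i): row, column.
   There is at most one arrow between two vertices. *)
Definition coef_arrow : rel ('I_n.+1 * 'I_n) := fun x y =>
  (x.1 == y.1) && [exists a : 'I_n.-1,
    [&& x.2 == An_src a, y.2 == An_tgt a & x.1 \notin R a]].

Definition QS : {set 'I_n.+1 * 'I_n} :=
  [set x : 'I_n.+1 * 'I_n | x.1 \in S x.2].

(* The full subquiver on X of the coefficient quiver is connected. *)
Definition connected_in_coef (X : {set 'I_n.+1 * 'I_n}) : bool :=
  [forall x in X, forall y in X,
    connect (fun p q =>
      [&& p \in X, q \in X & coef_arrow p q || coef_arrow q p]) x y].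

Definition segment (i : 'I_n.+1) (k h : 'I_n) : {set 'I_n.+1 * 'I_n} :=
  [set x : 'I_n.+1 * 'I_n | (x.1 == i) && (k <= x.2 <= h)%N].

Definition pos (i : 'I_n.+1) : {set 'I_n.-1} := [set a | i \in R a].

(* An arrow index a : 'I_n.-1 stands for the column An_src a, and An_tgt a is
   the next column. *)
Definition Sing_row (i : 'I_n.+1) : {set 'I_n.+1 * 'I_n} :=
  [set jc : 'I_n.+1 * 'I_n | [exists h in pos i,
    [&& jc.2 == An_tgt h, jc.1 \notin S (An_tgt h) &
      [exists k in pos jc.1,
        [&& (k <= h)%N,
            [forall t : 'I_n, (k <= t <= h)%N ==> (i \in S t)],
            segment i (An_src k) (An_src h) \subset QS
          & connected_in_coef (segment i (An_src k) (An_src h))]]]]].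

(* The first component tags the summand of the disjoint union. *)
Definition Sing : {set 'I_n.+1 * ('I_n.+1 * 'I_n)} :=
  [set x : 'I_n.+1 * ('I_n.+1 * 'I_n) | x.2 \in Sing_row x.1].

End Singularities.

(* Main.v *)
Require Import Defs.
From mathcomp Require Import all_boot all_order all_algebra.
From mathcomp Require Import reals complex.

(** The space Ext^1(M, N) of representations of a quiver is the cokernel of the
    differential that sends a family k of linear maps M y -> N y, one for each
    vertex, to the family N_a k - k M_a, one for each arrow a.  An extension is
    classified by the failure of a vertexwise section of its surjection to be a
    morphism (ext_overP), and this translates equivalence, scaling and Baer sum
    of extensions (dim_Ext1_cochain).  So it suffices to exhibit as many linear
    functionals on cochains as there are singularities, such that they are
    jointly onto and vanish together exactly on the coboundaries.

    For M = M_S and N = M^R / M_S the maps are diagonal in the bases of rows, so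
    the differential decouples into one problem for each pair (i, j) of a row i
    of M and a row j of N (coboundary_entry).  It is the difference operator
    from functions on the vertices to functions on the edges of a path: the
    vertices are the columns t with i in S_t and j not in S_t, the edges are the
    arrows a with i in S_a and j not in S_(a+1), and the edge a has lost its
    left end if j is in R_a and its right end if i is in R_a; admissibility
    says that all other ends of edges are vertices.  On a connected component
    the difference operator is onto, unless the component begins with an edge
    without left end and stops with an edge h without right end.  In that case
    its cokernel is one-dimensional and given by the sum over the edges
    (left_sum_both_open, primitiveP, left_sum_supported).  Such a component is
    determined by i, j and h, and its existence is the condition that (j, h+1)
    is in Sing_i (Sing_both_open). *)

Set Implicit Arguments.
Unset Strict Implicit.
Unset Printing Implicit Defensive.

Import GRing.Theory.
Local Open Scope ring_scope.

(** * Extensions and cocycles *)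

Section PairMaps.
Variable F : fieldType.
Implicit Types V W : vectType F.

Definition inl_lfun V W : 'Hom(V, (V * W)%type) := linfun (fun u => (u, 0)).
Definition inr_lfun V W : 'Hom(W, (V * W)%type) := linfun (fun u => (0, u)).
Definition snd_lfun V W : 'Hom((V * W)%type, W) := linfun snd.

Lemma inl_lfunE V W u : inl_lfun V W u = (u, 0).
Proof.
by rewrite linfun_linearE // => c x y; congr pair; rewrite /= scaler0 addr0.
Qed.

Lemma inr_lfunE V W u : inr_lfun V W u = (0, u).
Proof.
by rewrite linfun_linearE // => c x y; congr pair; rewrite /= scaler0 addr0.
Qed.

Lemma snd_lfunE V W u : snd_lfun V W u = u.2.
Proof. by rewrite linfun_linearE. Qed.

End PairMaps.

Section ExtensionClasses.
Variables (F : fieldType) (Q : quiver).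
Implicit Types M N : rep F Q.

(** The cokernel of the differential from the product over the vertices y of
    the spaces Hom(M y, N y) to these cochains is Ext^1(M, N): the path algebra
    of a quiver is hereditary, so every cochain is a cocycle. *)
Definition cochain M N := forall a : arrow Q, 'Hom(M (src a), N (tgt a)).

Definition is_coboundary M N (x : cochain M N) :=
  exists k : forall y, 'Hom(M y, N y), forall a u,
    x a u = rep_map N a (k (src a) u) - k (tgt a) (rep_map M a u).

(** x is a cocycle of the class of E: the defect of some vertexwise linear
    section s of the surjection to commute with the maps of the
    representations. *)
Definition splits_up_to M N (E : extension M N) (x : cochain M N) :=
  exists s : forall y, 'Hom(M y, ext_mid E y),
    (forall y u, ext_surj E y (s y u) = u) /\
    (forall a u, rep_map (ext_mid E) a (s (src a) u) =
       s (tgt a) (rep_map M a u) + ext_inj E (tgt a) (x a u)).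

Lemma rep_homE M N (f : rep_hom M N) a u :
  rep_map N a (f (src a) u) = f (tgt a) (rep_map M a u).
Proof. by rewrite -!comp_lfunE rep_hom_comm. Qed.

Lemma ext_injK M N (E : extension M N) y : cancel (ext_inj E y) (ext_inj E y)^-1%VF.
Proof. by apply: lker0_lfunK; apply/eqP; apply: ext_inj_ker. Qed.

Lemma ext_inj_inj M N (E : extension M N) y : injective (ext_inj E y).
Proof. exact: (can_inj (@ext_injK _ _ E y)). Qed.

Lemma ext_injVK M N (E : extension M N) y w :
  ext_surj E y w = 0 -> ext_inj E y ((ext_inj E y)^-1%VF w) = w.
Proof.
by move=> w0; apply: limg_lfunVK; rewrite ext_exact memv_ker w0.
Qed.

Lemma ext_surj_inj M N (E : extension M N) y u : ext_surj E y (ext_inj E y u) = 0.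
Proof. by apply/eqP; rewrite -memv_ker -ext_exact memv_img ?memvf. Qed.

Definition ext_section M N (E : extension M N) y : 'Hom(M y, ext_mid E y) :=
  ((ext_surj E y)^-1)%VF.

Lemma ext_sectionK M N (E : extension M N) y u :
  ext_surj E y (ext_section E y u) = u.
Proof. by apply: limg_lfunVK; rewrite ext_surj_img memvf. Qed.

Definition section_defect M N (E : extension M N) : cochain M N := fun a =>
  ((ext_inj E (tgt a))^-1 \o
    ((rep_map (ext_mid E) a \o ext_section E (src a))
     - (ext_section E (tgt a) \o rep_map M a)))%VF.

Lemma section_defectP M N (E : extension M N) : splits_up_to E (section_defect E).
Proof.
exists (ext_section E); split=> [y u|a u]; first exact: ext_sectionK.
rewrite /section_defect comp_lfunE ext_injVK.
  by rewrite add_lfunE opp_lfunE !comp_lfunE addrC subrK.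
by rewrite add_lfunE opp_lfunE !comp_lfunE linearB /= -rep_homE !ext_sectionK subrr.
Qed.

(** The morphisms of extensions over (f, g) are the translates of a diagonal
    one.  In the vertexwise decompositions E = N + s(M) and E' = N' + s'(M'),
    such a morphism is the matrix with diagonal (f, g) and one free entry
    k : M -> N', and it commutes with the arrows exactly when the coboundary of
    k is f x - x' g. *)
Lemma ext_overP M N M' N' (f : rep_hom N N') (g : rep_hom M M')
    (E : extension M N) (E' : extension M' N') x x' (z : cochain M N') :
    splits_up_to E x -> splits_up_to E' x' ->
    (forall a u, z a u = f (tgt a) (x a u) - x' a (g (src a) u)) ->
  ext_over f g E E' <-> is_coboundary z.
Proof.
move=> [s [sK sE]] [s' [s'K s'E]] zE; split=> [[h hE]|[k kE]].
  have h_inj y u : h y (ext_inj E y u) = ext_inj E' y (f y u).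
    by have [/lfunP/(_ u)] := hE y; rewrite !comp_lfunE.
  have h_surj y u : ext_surj E' y (h y u) = g y (ext_surj E y u).
    by have [_ /lfunP/(_ u)] := hE y; rewrite !comp_lfunE.
  (* h s and s' g have the same image in M', so they differ by an element of N'. *)
  pose k y := ((ext_inj E' y)^-1 \o ((h y \o s y) - (s' y \o g y)))%VF.
  have kE y u : ext_inj E' y (k y u) = h y (s y u) - s' y (g y u).
    rewrite comp_lfunE ext_injVK add_lfunE opp_lfunE !comp_lfunE //.
    by rewrite linearB /= h_surj sK s'K subrr.
  exists k => a u; apply: (@ext_inj_inj _ _ E'); rewrite zE !linearB /=.
  rewrite -rep_homE !kE linearB /= rep_homE sE s'E linearD /= h_inj rep_homE.
  set A := h _ _; set B := s' _ _; set C := ext_inj _ _ _.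
  by rewrite opprD addrACA [X in _ = X - _]addrC addrK.
(* The projection onto N along s(M). *)
pose r y := ((ext_inj E y)^-1 \o (\1 - (s y \o ext_surj E y)))%VF.
have rE y w : ext_inj E y (r y w) = w - s y (ext_surj E y w).
  rewrite comp_lfunE ext_injVK add_lfunE opp_lfunE comp_lfunE id_lfunE //.
  by rewrite linearB /= sK subrr.
pose h y : 'Hom(ext_mid E y, ext_mid E' y) := ((ext_inj E' y \o f y \o r y)
   + (((s' y \o g y) + (ext_inj E' y \o k y)) \o ext_surj E y))%VF.
have hE y w : h y w = ext_inj E' y (f y (r y w))
    + (s' y (g y (ext_surj E y w)) + ext_inj E' y (k y (ext_surj E y w))).
  by rewrite /h !(add_lfunE, comp_lfunE).
have h_inj y u : h y (ext_inj E y u) = ext_inj E' y (f y u).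
  have -> : h y (ext_inj E y u) = ext_inj E' y (f y (r y (ext_inj E y u))).
    by rewrite hE ext_surj_inj !linear0 !addr0.
  suff -> : r y (ext_inj E y u) = u by [].
  by apply: (@ext_inj_inj _ _ E); rewrite rE ext_surj_inj linear0 subr0.
have h_s y u : h y (s y u) = s' y (g y u) + ext_inj E' y (k y u).
  rewrite hE sK.
  suff -> : r y (s y u) = 0 by rewrite !linear0 add0r.
  by apply: (@ext_inj_inj _ _ E); rewrite rE sK subrr linear0.
have h_comm a : (rep_map (ext_mid E') a \o h (src a) =
                 h (tgt a) \o rep_map (ext_mid E) a)%VF.
  apply/lfunP=> w; rewrite !comp_lfunE.
  rewrite -[w](subrK (s (src a) (ext_surj E (src a) w))) -rE.
  move: (r _ w) (ext_surj E _ w) => m u; rewrite !linearD /=; congr (_ + _).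
    by rewrite h_inj !rep_homE h_inj.
  rewrite h_s sE !linearD /= h_s h_inj s'E !rep_homE -!addrA; congr (_ + _).
  rewrite -!linearD; congr (ext_inj _ _ _); rewrite [_ + f _ _]addrC.
  by rewrite -(subrK (x' a (g _ u)) (f _ _)) -zE kE addrAC subrK addrC.
exists (RepHom h_comm) => y; split; apply/lfunP=> u; rewrite !comp_lfunE /=.
  by rewrite h_inj.
by rewrite hE !linearD /= !ext_surj_inj s'K addr0 add0r.
Qed.

(** The underlying spaces are N y + M y; x enters as the upper right block of
    the triangular matrix of each arrow. *)
Definition cocycle_ext_mid M N (x : cochain M N) : rep F Q :=
  Rep (rep_space := fun y => (N y * M y)%type)
    (fun a => linfun (fun u : N (src a) * M (src a) =>
       (rep_map N a u.1 + x a u.2, rep_map M a u.2))).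

Lemma cocycle_ext_midE M N (x : cochain M N) a u :
  rep_map (cocycle_ext_mid x) a u
    = (rep_map N a u.1 + x a u.2, rep_map M a u.2).
Proof.
rewrite linfun_linearE // => c w w'; congr pair; rewrite /= !linearP //.
by rewrite scalerDr addrACA.
Qed.

Lemma cocycle_ext_inj_comm M N (x : cochain M N) a :
  (rep_map (cocycle_ext_mid x) a \o inl_lfun (N (src a)) (M (src a)) =
   inl_lfun (N (tgt a)) (M (tgt a)) \o rep_map N a)%VF.
Proof.
apply/lfunP=> u; rewrite !comp_lfunE !inl_lfunE.
by rewrite cocycle_ext_midE /= !linear0 addr0.
Qed.

Lemma cocycle_ext_surj_comm M N (x : cochain M N) a :
  (rep_map M a \o snd_lfun (N (src a)) (M (src a)) =
   snd_lfun (N (tgt a)) (M (tgt a)) \o rep_map (cocycle_ext_mid x) a)%VF.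
Proof.
apply/lfunP=> u; rewrite !comp_lfunE !snd_lfunE.
by rewrite cocycle_ext_midE.
Qed.

Definition cocycle_ext_inj M N (x : cochain M N) : rep_hom N (cocycle_ext_mid x) :=
  @RepHom _ _ N (cocycle_ext_mid x) (fun y => inl_lfun (N y) (M y))
    (cocycle_ext_inj_comm x).

Definition cocycle_ext_surj M N (x : cochain M N) : rep_hom (cocycle_ext_mid x) M :=
  @RepHom _ _ (cocycle_ext_mid x) M (fun y => snd_lfun (N y) (M y))
    (cocycle_ext_surj_comm x).

Lemma cocycle_ext_inj_ker M N (x : cochain M N) y :
  lker (cocycle_ext_inj x y) = 0%VS.
Proof.
apply/eqP/lker0P=> u w /=.
by rewrite !inl_lfunE => -[].
Qed.

Lemma cocycle_ext_exact M N (x : cochain M N) y :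
  limg (cocycle_ext_inj x y) = lker (cocycle_ext_surj x y).
Proof.
apply/vspaceP=> -[u w]; rewrite memv_ker /= snd_lfunE.
apply/memv_imgP/eqP => [[u' _]|/= ->].
  by rewrite inl_lfunE => -[].
by exists u; rewrite ?memvf // inl_lfunE.
Qed.

Lemma cocycle_ext_surj_img M N (x : cochain M N) y :
  limg (cocycle_ext_surj x y) = fullv.
Proof.
apply/vspaceP=> w; rewrite memvf; apply/memv_imgP; exists (0, w).
  exact: memvf.
by rewrite snd_lfunE.
Qed.

Definition cocycle_ext M N (x : cochain M N) : extension M N :=
  Extension (cocycle_ext_inj_ker x) (cocycle_ext_exact x)
    (cocycle_ext_surj_img x).

Lemma cocycle_extP M N (x : cochain M N) : splits_up_to (cocycle_ext x) x.
Proof.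
exists (fun y => inr_lfun (N y) (M y)); split=> [y u|a u] /=.
  by rewrite snd_lfunE inr_lfunE.
rewrite !inr_lfunE inl_lfunE.
rewrite cocycle_ext_midE /= linear0.
by congr pair; rewrite /= ?add0r ?addr0.
Qed.

Lemma sum_extension_splits M N M' N' (E : extension M N) (E' : extension M' N') x x' :
    splits_up_to E x -> splits_up_to E' x' ->
  splits_up_to (sum_extension E E') (fun a => prod_lfun (x a) (x' a)).
Proof.
move=> [s [sK sE]] [s' [s'K s'E]].
exists (fun y => prod_lfun (s y) (s' y)); split=> [y u|a u] /=.
  by rewrite !prod_lfunE /= sK s'K; case: u.
by rewrite !prod_lfunE /= sE s'E.
Qed.

(** Ext^1 may be computed from cochains: equivalence, scaling and Baer sum of
    extensions become equality, scaling and sum of cocycles modulo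
    coboundaries, by ext_overP for the morphisms (1, 1), (c, 1) and, for the
    Baer sum, (1, diagonal) and (codiagonal, 1).  Every class of cochains occurs
    by cocycle_extP. *)
Lemma dim_Ext1_cochain M N d (Phi : cochain M N -> 'rV[F]_d) :
    (forall c (x y z : cochain M N), (forall a u, z a u = c *: x a u + y a u) ->
       Phi z = c *: Phi x + Phi y) ->
    (forall x, Phi x = 0 <-> is_coboundary x) ->
    (forall w, exists x, Phi x = w) ->
  dim_Ext1 M N d.
Proof.
move=> PhiP Phi0 Phi_surj.
have PhiB (x y z : cochain M N) : (forall a u, z a u = x a u - y a u) -> Phi z = Phi x - Phi y.
  move=> zE; rewrite (PhiP (-1) y x) ?scaleN1r 1?addrC // => a u.
  by rewrite zE scaleN1r addrC.
have Phi_eq (x y z : cochain M N) : (forall a u, z a u = x a u - y a u) ->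
    Phi x = Phi y <-> is_coboundary z.
  move=> zE; rewrite -Phi0 (PhiB _ _ _ zE).
  by split=> [->|]; [rewrite subrr | apply: subr0_eq].
pose zero : cochain M N := fun=> 0%VF.
have PhiZ c (x z : cochain M N) : (forall a u, z a u = c *: x a u) -> Phi z = c *: Phi x.
  move=> zE; rewrite (PhiP c x zero) => [|a u].
    suff -> : Phi zero = 0 by rewrite addr0.
    apply/Phi0; exists (fun=> 0%VF) => a u.
    by rewrite !zero_lfunE linear0 subr0.
  by rewrite zE zero_lfunE addr0.
have splits_Phi E x : splits_up_to E x -> Phi (section_defect E) = Phi x.
  move=> Ex; apply/(Phi_eq _ _ (fun a => section_defect E a - x a)) => [a u|].
    by rewrite add_lfunE opp_lfunE.
  apply/(ext_overP (f := id_hom N) (g := id_hom M)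
    (section_defectP E) Ex).
    by move=> a u; rewrite add_lfunE opp_lfunE !id_lfunE.
  by exists (id_hom _) => y; rewrite !comp_lfun1l !comp_lfun1r.
exists (fun E => Phi (section_defect E)); split=> [E E'|w|E1 E2 E|c E1 E].
- rewrite /ext_equiv (ext_overP
    (z := fun a => section_defect E a - section_defect E' a)
    (section_defectP E) (section_defectP E')) => [|a u]; last first.
    by rewrite add_lfunE opp_lfunE !id_lfunE.
  by apply: Phi_eq => a u; rewrite add_lfunE opp_lfunE.
- have [x <-] := Phi_surj w; exists (cocycle_ext x).
  exact/splits_Phi/cocycle_extP.
- pose x1 := section_defect E1; pose x2 := section_defect E2.
  pose x := section_defect E.
  have Phi_add (z z' w : cochain M N) : (forall a u, w a u = z a u + z' a u) ->
      Phi w = Phi z + Phi z'.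
    by move=> wE; rewrite (PhiP 1 z z') ?scale1r // => a u; rewrite wE scale1r.
  have codiagE P (y : cochain M (rep_sum N N)) : splits_up_to P y ->
      ext_over (codiag_hom N) (id_hom M) P E <->
      Phi (fun a => codiag_lfun _ \o y a)%VF = Phi x.
    move=> Py; rewrite (ext_overP
      (z := fun a => (codiag_lfun _ \o y a)%VF - x a)
      Py (section_defectP E)) => [|a u]; last first.
      by rewrite add_lfunE opp_lfunE comp_lfunE id_lfunE.
    apply: iff_sym; apply: Phi_eq => a u.
    by rewrite add_lfunE opp_lfunE.
  (* The cocycle of the pullback of E1 + E2 along the diagonal. *)
  pose y0 : cochain M (rep_sum N N) := fun a =>
    (prod_lfun (x1 a) (x2 a) \o diag_lfun _)%VF.
  have y0E : Phi (fun a => codiag_lfun _ \o y0 a)%VF = Phi x1 + Phi x2.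
    apply: Phi_add => a u.
    by rewrite 2!comp_lfunE codiag_lfunE prod_lfunE diag_lfunE.
  have splits_sum := sum_extension_splits (section_defectP E1) (section_defectP E2).
  have diagE P (y : cochain M (rep_sum N N)) : splits_up_to P y ->
      ext_over (id_hom (rep_sum N N)) (diag_hom M) P (sum_extension E1 E2) <->
      is_coboundary (fun a => y a - y0 a).
    move=> Py; apply: (ext_overP Py splits_sum) => a u.
    by rewrite add_lfunE opp_lfunE comp_lfunE id_lfunE.
  rewrite -y0E; split=> [Phi_y0|[P [Pdiag Pcodiag]]].
    exists (cocycle_ext y0); split.
      apply/(diagE _ _ (cocycle_extP y0)); exists (fun=> 0%VF) => a u.
      by rewrite subrr !zero_lfunE linear0 subr0.
    exact/(codiagE _ _ (cocycle_extP y0)).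
  have Py := section_defectP P.
  have <- := (codiagE _ _ Py).1 Pcodiag.
  have [k kE] := (diagE _ _ Py).1 Pdiag.
  apply/(Phi_eq _ _ (fun a => codiag_lfun _ \o (section_defect P a - y0 a))%VF).
    by move=> a u; rewrite comp_lfunE add_lfunE opp_lfunE linearB !comp_lfunE. 
  exists (fun v => codiag_lfun _ \o k v)%VF => a u.
    rewrite !comp_lfunE kE !codiag_lfunE prod_lfunE /= linearD.
    by rewrite opprD addrACA.
- rewrite /is_ext_scale (ext_overP
    (z := fun a => c *: section_defect E1 a - section_defect E a)
    (section_defectP E1) (section_defectP E)) => [|a u]; last first.
    by rewrite add_lfunE opp_lfunE !scale_lfunE !id_lfunE.
  pose cx : cochain M N := fun a => c *: section_defect E1 a.
  rewrite -(PhiZ c (section_defect E1) cx) => [|a u]; last by rewrite scale_lfunE.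
  rewrite -(Phi_eq cx (section_defect E)) => [|a u]; first by split.
  by rewrite add_lfunE opp_lfunE.
Qed.

End ExtensionClasses.

(** * Differences on a path with cut edges *)

Section PathComplex.
Variables (F : fieldType) (p q e : pred nat).
Implicit Types x f : nat -> F.

(** The combinatorial model is a path with vertices 0, 1, 2, ... in which the
    edge a, present if e a, joins the vertices a and a.+1, but its left end is
    cut off if p a and its right end is cut off if q a.  Then open_left t says
    that the component of t, followed to the left, ends with an edge cut off at
    its left end rather than with a vertex. *)
Fixpoint open_left (t : nat) : bool :=
  if t is a.+1 then [&& e a, ~~ q a & p a || open_left a] else false.

(** The edge h is the last one of a component in which both extreme edges are
    cut off.  Such a component has one edge more than it has vertices, and
    these are the only components over which path_diff fails to be onto. *)
Definition both_open (h : nat) : bool := [&& e h, q h & p h || open_left h].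

(** Minus the sum of x over the edges from the last left cut to the vertex t;
    this is the value at t forced upon a primitive of x in a component that is
    open on the left. *)
Fixpoint left_sum x (t : nat) : F :=
  if t is a.+1 then (if p a then 0 else left_sum x a) - x a else 0.

(** The value at t forced by integrating from the next right cut; m bounds the
    number of edges still to be visited. *)
Fixpoint right_sum x (t m : nat) : F :=
  if m is m'.+1 then x t + (if q t then 0 else right_sum x t.+1 m') else 0.

Definition path_diff f (a : nat) : F :=
  (if p a then 0 else f a) - (if q a then 0 else f a.+1).

Lemma left_sum_linear c x y t :
  left_sum (fun a => c * x a + y a) t = c * left_sum x t + left_sum y t.
Proof.
elim: t => [|t IHt] /=; first by rewrite mulr0 addr0.
case: ifP => _; last by rewrite IHt mulrBr opprD addrACA.
by rewrite !sub0r mulrN opprD.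
Qed.

Lemma eq_left_sum x y t :
  (forall a, (a < t)%N -> x a = y a) -> left_sum x t = left_sum y t.
Proof.
elim: t => //= t IHt xy; rewrite IHt ?xy // => a at_; apply: xy.
exact: ltnW.
Qed.

Lemma left_sum_diff x f t :
  (forall a, e a -> x a = path_diff f a) -> open_left t -> left_sum x t = f t.
Proof.
move=> xE; elim: t => //= a IHa /and3P[ea qa pa]; rewrite xE // /path_diff.
rewrite (negPf qa); case: ifP pa => [_ _|_ /= /IHa ->].
  by rewrite !sub0r opprK.
by rewrite opprB addrC subrK.
Qed.

(** The differences telescope over a component, and both ends are cut off, so
    that no boundary term is left. *)
Lemma left_sum_both_open x f h :
  (forall a, e a -> x a = path_diff f a) -> both_open h ->
  left_sum x h.+1 = 0.
Proof.
move=> xE /and3P[eh qh ph] /=; rewrite xE // /path_diff qh subr0.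
case: ifP ph => [_ _|_ /= /(left_sum_diff xE) ->]; exact: subrr.
Qed.

(** A component that is open on the left is integrated from its left end; the
    others begin with a vertex, where the value is free, and are integrated from
    the right, which also satisfies a possible right cut. *)
Definition primitive x n t : F :=
  if open_left t then left_sum x t else right_sum x t (n - t).

(** Integration can only fail at the last edge of a component with both ends
    open, where the equation left over is the vanishing of left_sum. *)
Lemma primitiveP x n a : (a < n)%N -> e a ->
    (forall h, both_open h -> left_sum x h.+1 = 0) ->
  path_diff (primitive x n) a = x a.
Proof.
move=> an ea vanish; rewrite /path_diff /primitive /=.
have -> : (n - a = (n - a.+1).+1)%N by rewrite subnSK.
move: (vanish a); rewrite /both_open /= ea /=.
case: (p a); case: (q a) => /=.
- by move=> /(_ isT)/eqP; rewrite sub0r oppr_eq0 => /eqP->; rewrite subrr.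
- by move=> _; rewrite !sub0r opprK.
- case: (open_left a) => [/(_ isT)/eqP|_]; last by rewrite addr0 subr0.
  by rewrite subr_eq0 subr0 => /eqP.
- by case: (open_left a) => _; [rewrite opprB addrC subrK | rewrite addrK].
Qed.

(** A component contains at most one edge with a right cut, its last one; so
    the sums over distinct components with both ends open can be prescribed
    independently. *)
Lemma left_sum_supported x h : (forall a, ~~ both_open a -> x a = 0) ->
  both_open h -> left_sum x h.+1 = - x h.
Proof.
move=> x0 /and3P[_ _ ph] /=.
suff -> : (if p h then 0 else left_sum x h) = 0 by rewrite sub0r.
case: ifP ph => //= _; elim: h => //= a IHa /and3P[_ qa pa].
rewrite x0 ?subr0; last by rewrite /both_open (negPf qa) andbF.
by case: ifP pa => //= _ /IHa.
Qed.

Lemma open_left_witness t : open_left t ->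
  exists2 k, (k < t)%N & p k /\ forall a, (k <= a < t)%N -> e a && ~~ q a.
Proof.
elim: t => //= t IHt /and3P[et qt]; case: (boolP (p t)) => [pt _|_ /= /IHt].
  by exists t => //; split=> // a; rewrite ltnS -eqn_leq => /eqP <-; rewrite et.
case=> k kt [pk kE]; exists k; first exact: ltnW.
split=> // a /andP[ka]; rewrite ltnS leq_eqVlt => /predU1P[->|at_].
  by rewrite et.
by rewrite kE ?ka.
Qed.

(** The last hypothesis lets the component be continued to the left of an edge
    that is not cut.  The last left cut before h is the one that makes the
    component open; it may be to the right of k. *)
Lemma open_left_intro k h : (k <= h)%N -> p k -> e h ->
    (forall a, (k <= a < h)%N -> ~~ q a) ->
    (forall a, (k <= a < h)%N -> e a.+1 -> ~~ p a.+1 -> e a) ->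
  p h || open_left h.
Proof.
move=> kh pk; elim: h kh => [|h IHh].
  by rewrite leqn0 => /eqP k0; rewrite -k0 pk.
rewrite leq_eqVlt => /predU1P[<-|]; rewrite ?pk // ltnS => kh eh qP eP.
case: (boolP (p h.+1)) => //= ph.
have khh : (k <= h < h.+1)%N by rewrite kh ltnSn.
have eh' : e h := eP h khh eh ph.
rewrite eh' qP //=; apply: IHh => // a /andP[ka ah]; [apply: qP|apply: eP];
by rewrite ka ltnW.
Qed.

End PathComplex.

(** * Matrix coefficients in the bases of rows *)

Section Entries.
Variables (F : fieldType) (n : nat) (v : n.+1.-tuple 'rV[F]_n.+1).
Hypothesis vB : basis_of fullv v.
Implicit Types (A B : {set 'I_n.+1}) (i j : 'I_n.+1).
Local Notation U := (span_rows v).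

Lemma coord_row i j : coord v j v`_i = (i == j)%:R.
Proof. by rewrite coord_free ?(basis_free vB). Qed.

Lemma mem_span_rows A i : i \in A -> v`_i \in U A.
Proof.
by move=> iA; apply/memv_span/mapP; exists i; rewrite ?mem_enum.
Qed.

Lemma coord_span_rows A j w : w \in U A -> j \notin A -> coord v j w = 0.
Proof.
rewrite /span_rows; set X := map _ _ => wX jA.
rewrite (coord_span (X := in_tuple X) wX) linear_sum big1 // => l _.
have /mapP[i iA lE] : (in_tuple X)`_l \in X by rewrite mem_nth.
rewrite linearZ /= lE coord_row; case: eqP => [ij|_]; last by rewrite mulr0.
by rewrite -ij -mem_enum iA in jA.
Qed.

Lemma row_expand w : w = \sum_i coord v i w *: v`_i.
Proof. exact: coord_basis vB (memvf w). Qed.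

Definition sub_row A i : subvs_of (U A) := vsproj (U A) v`_i.
Definition quo_row A j : subvs_of (U A)^C := quo_lfun (U A) v`_j.

Lemma sub_row_expand A (u : subvs_of (U A)) :
  u = \sum_(i in A) coord v i (vsval u) *: sub_row A i.
Proof.
apply: val_inj; rewrite /= linear_sum {1}[vsval u]row_expand (bigID (mem A)) /=.
rewrite [X in _ + X]big1 ?addr0 => [|i iA]; last first.
  by rewrite (coord_span_rows (subvsP u)) ?scale0r.
by apply: eq_bigr => i iA; rewrite /= vsprojK ?mem_span_rows //.
Qed.

(** The complement that models the quotient is arbitrary, yet the coordinates
    outside A do not depend on it, because they vanish on the span of the rows
    in A. *)
Lemma coord_quo A j w : j \notin A ->
  coord v j (vsval (quo_lfun (U A) w)) = coord v j w.
Proof.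
move=> jA; rewrite quo_lfunE.
have wE : w = daddv_pi (U A)^C (U A) w + daddv_pi (U A) (U A)^C w.
  by rewrite daddv_pi_add ?capCv // addvC addv_complf memvf.
by rewrite [in RHS]wE linearD /= (coord_span_rows (memv_pi _ _ w)) ?addr0.
Qed.

Lemma quo_row_expand A (w : subvs_of (U A)^C) :
  w = \sum_(j | j \notin A) coord v j (vsval w) *: quo_row A j.
Proof.
have {1}-> : w = quo_lfun (U A) (vsval w).
  by apply: val_inj; rewrite /= quo_lfunE daddv_pi_id ?capCv ?subvsP.
rewrite {1}[vsval w]row_expand linear_sum (bigID (mem A)) /=.
rewrite big1 ?add0r => [|i iA]; last first.
  have /eqP : quo_lfun (U A) v`_i == 0 by rewrite -memv_ker lker_quo mem_span_rows.
  by rewrite linearZ => /= ->; rewrite scaler0.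
by apply: eq_bigr => i iA; rewrite linearZ.
Qed.

Section HomEntries.
Variables A B : {set 'I_n.+1}.
Implicit Types x y : 'Hom(subvs_of (U A), subvs_of (U B)^C).

(** The matrix coefficients of x, meaningful for i in A and j outside B, in the
    bases of the rows in A of the subspace and of the classes of the rows
    outside B of the quotient. *)
Definition entry x i j : F := coord v j (vsval (x (sub_row A i))).

Definition of_entries (c : 'I_n.+1 -> 'I_n.+1 -> F) :
    'Hom(subvs_of (U A), subvs_of (U B)^C) :=
  linfun (fun u => \sum_(i in A) \sum_(j | j \notin B)
    (coord v i (vsval u) * c i j) *: quo_row B j).

Lemma entry_of_entries c i j : i \in A -> j \notin B ->
  entry (of_entries c) i j = c i j.
Proof.
move=> iA jB; rewrite /entry linfun_linearE => [|a u w]; last first.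
  rewrite scaler_sumr -big_split; apply: eq_bigr => k kA.
  rewrite scaler_sumr -big_split; apply: eq_bigr => l lB.
  by rewrite /= !linearP /= mulrDl scalerDl scalerA mulrA.
rewrite !linear_sum (bigD1 i) //= [X in _ + X]big1 ?addr0 => [|k /andP[kA ki]].
  rewrite !linear_sum (bigD1 j) //= [X in _ + X]big1 ?addr0 => [|l /andP[lB lj]].
    by rewrite !linearZ /= vsprojK ?mem_span_rows // coord_quo // !coord_row
      !eqxx mul1r mulr1.
  by rewrite !linearZ /= coord_quo // coord_row (negPf lj) mulr0.
rewrite !linear_sum big1 // => l lB; rewrite vsprojK ?mem_span_rows // coord_row.
by rewrite eq_sym (negPf ki) mul0r scale0r !linear0.
Qed.

Lemma entry_inj x y :
  (forall i j, i \in A -> j \notin B -> entry x i j = entry y i j) ->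
  forall u, x u = y u.
Proof.
move=> xy u; rewrite [u]sub_row_expand !linear_sum; apply: eq_bigr => i iA.
rewrite !linearZ; congr (_ *: _); rewrite /= [LHS]quo_row_expand.
by rewrite [RHS]quo_row_expand; apply: eq_bigr => j jB; rewrite -!/(entry _ _ _) xy.
Qed.

End HomEntries.

Lemma coord_proj_R A j w :
  coord v j (proj_R v A w) = if j \in A then 0 else coord v j w.
Proof.
rewrite [w in LHS]row_expand !linear_sum /=.
rewrite (bigD1 j) //= big1 ?addr0 => [|i ij].
  rewrite !linearZ /= proj_RE //; case: ifP => _.
    by rewrite linear0 mulr0.
  by rewrite coord_row eqxx mulr1.
rewrite !linearZ /= proj_RE //; case: ifP => _; first by rewrite linear0 mulr0.
by rewrite coord_row (negPf ij) mulr0.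
Qed.

Section Coboundary.
Variables (R : 'I_n.-1 -> {set 'I_n.+1}) (S : 'I_n -> {set 'I_n.+1}).
Hypothesis adm : admissible R S.
Local Notation M := (rep_sub (MS vB adm)).
Local Notation N := (rep_quo (MS vB adm)).

Lemma sub_map_row (a : 'I_n.-1) i : i \in S (An_src a) ->
  rep_map M a (sub_row (S (An_src a)) i) =
    if i \in R a then 0 else sub_row (S (An_tgt a)) i.
Proof.
move=> iS; rewrite /= linfun_linearE => [|c x y]; last by rewrite !linearP.
rewrite vsprojK ?mem_span_rows // proj_RE //.
by case: ifP => // _; rewrite linear0.
Qed.

Lemma coord_quo_map (a : 'I_n.-1) j (w : N (An_src a)) : j \notin S (An_tgt a) ->
  coord v j (vsval (rep_map N a w)) = if j \in R a then 0 else coord v j (vsval w).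
Proof.
by move=> jS; rewrite /= !comp_lfunE coord_quo // incl_lfunE coord_proj_R.
Qed.

End Coboundary.
End Entries.

(** * Singularities as components of paths *)

Section SingPath.
Variables (n : nat) (R : 'I_n.-1 -> {set 'I_n.+1}) (S : 'I_n -> {set 'I_n.+1}).
Hypothesis adm : admissible R S.
Implicit Types (i j : 'I_n.+1) (a k h : 'I_n.-1).

Definition at_arrow T (d : T) (g : 'I_n.-1 -> T) (t : nat) : T :=
  if insub t is Some a then g a else d.

Lemma at_arrowE T (d : T) g a : at_arrow d g a = g a.
Proof. by rewrite /at_arrow valK. Qed.

Lemma at_arrow_true (g : pred 'I_n.-1) t :
  at_arrow false g t -> exists2 a, val a = t & g a.
Proof. by rewrite /at_arrow; case: insubP => // a _ <- ga; exists a. Qed.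

Definition cut i : pred nat := at_arrow false (fun a => i \in R a).

(** The edges of the path of (i, j): the arrows at which a cochain has a
    coefficient at (i, j).  An edge has lost its left end if cut j holds, since
    then the quotient kills row j, and its right end if cut i holds. *)
Definition edge i j : pred nat :=
  at_arrow false (fun a => (i \in S (An_src a)) && (j \notin S (An_tgt a))).

(** Admissibility at the arrow a: if row j is not killed by a and is not in the
    subrepresentation after a, it was not there before a. *)
Lemma edge_pred i j a t : (t.+1 = a)%N ->
    (forall b : 'I_n.-1, val b = t -> i \in S (An_src b)) ->
  edge i j a -> ~~ cut j a -> edge i j t.
Proof.
move=> ta iSt; rewrite /edge /cut !at_arrowE => /andP[_ jS] jR.
have tn : (t < n.-1)%N by rewrite (leq_trans _ (ltn_ord a)) // -ta ltnW.
pose b := Ordinal tn.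
have -> : t = b by [].
rewrite at_arrowE iSt //=; have -> : An_tgt b = An_src a by apply: val_inj.
apply: contra jS => /(subsetP (adm.2 a)); rewrite inE (negPf jR) orbF //.
Qed.

Let seg_rel (X : {set 'I_n.+1 * 'I_n}) : rel ('I_n.+1 * 'I_n) :=
  fun x y => [&& x \in X, y \in X & coef_arrow R x y || coef_arrow R y x].

(** A segment of a row is disconnected exactly by a missing arrow: if the arrow
    a is missing, the part in the columns up to a is closed under adjacency. *)
Lemma connected_segmentP i k h : (k <= h)%N ->
  reflect (forall a, (k <= a < h)%N -> i \notin R a)
    (connected_in_coef R (segment i (An_src k) (An_src h))).
Proof.
move=> kh; set X := segment _ _ _.
have end_in (b : 'I_n.-1) : (k <= b <= h)%N -> (i, An_src b) \in X by rewrite inE eqxx.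
apply: (iffP forallP) => [conn a /andP[ka ah]|uncut].
  have /implyP := conn (i, An_src k); rewrite end_in ?leqnn //= => /(_ isT).
  move/forallP/(_ (i, An_src h))/implyP; rewrite end_in ?leqnn ?andbT //.
  move=> /(_ isT) kh_conn; apply/negP=> ia.
  pose left_part : pred ('I_n.+1 * 'I_n) := [pred x : 'I_n.+1 * 'I_n | (x.2 <= a)%N].
  suff left_closed : closed (seg_rel X) left_part.
    by have := closed_connect left_closed kh_conn; rewrite !inE /= ka leqNgt ah.
  have arrow_left x y : x \in X -> coef_arrow R x y ->
      (x \in left_part) = (y \in left_part).
    rewrite inE => /andP[/eqP xi _] /andP[_ /existsP[b]].
    rewrite xi => /and3P[/eqP x2 /eqP y2 ib].
    rewrite !inE x2 y2 /= leq_eqVlt; case: eqP => // /val_inj ba.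
    by rewrite ba ia in ib.
  move=> x y /and3P[xX yX /orP[xy|yx]]; first exact: arrow_left.
  by apply/esym/arrow_left.
have conn_k t : (k + t <= h)%N -> forall b, val b = (k + t)%N ->
    connect (seg_rel X) (i, An_src k) (i, An_src b).
  elim: t => [|t IHt] th b bE.
    have -> : b = k by apply: val_inj; rewrite bE addn0.
    exact: connect0.
  have tn : (k + t < n.-1)%N.
    by rewrite (leq_trans _ (ltn_ord b)) // bE addnS.
  pose c := Ordinal tn.
  apply: connect_trans (IHt _ c erefl) _; first by rewrite ltnW // -addnS.
  have th' : (k + t < h)%N by rewrite -addnS.
  apply: connect1; rewrite /seg_rel !end_in /= ?leq_addr ?(ltnW th') //; last first.
    by rewrite bE leq_addr.
  apply/orP; left; rewrite /coef_arrow eqxx /=; apply/existsP; exists c.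
  rewrite eqxx uncut ?andbT /= ?leq_addr ?th' //.
  by rewrite -(inj_eq val_inj) /= bE addnS.
have seg_sym : connect_sym (seg_rel X).
  by apply: sym_connect_sym => x y; rewrite /seg_rel orbC andbCA.
have conn_all x : x \in X -> connect (seg_rel X) (i, An_src k) x.
  rewrite inE => /andP[/eqP xi /andP[kx xh]].
  have xn : (x.2 < n.-1)%N := leq_ltn_trans xh (ltn_ord h).
  have -> : x = (i, An_src (Ordinal xn)).
    by case: x xi {kx xh} xn => x1 x2 /= -> xn; congr pair; apply: val_inj.
  by apply: (conn_k (x.2 - k)%N); rewrite subnKC //= ltnW.
move=> x; apply/implyP=> xX; apply/forallP=> y; apply/implyP=> yX.
by apply: connect_trans (conn_all y yX); rewrite seg_sym conn_all.
Qed.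

(** The singularities of row i with first coordinate j are the last edges of
    the components with both ends open in the path of (i, j).  The k of the
    definition of Sing is any left cut, whereas the component begins at the last
    one before h. *)
Lemma Sing_both_open i j (c : 'I_n) :
  reflect (exists2 h, c = An_tgt h & both_open (cut j) (cut i) (edge i j) h)
    ((i, (j, c)) \in Sing R S).
Proof.
rewrite !inE /=; apply: (iffP existsP) => [[h]|[h -> /and3P[eh qh ph]]].
  rewrite inE => /andP[ih /and3P[/eqP cE jS /existsP[k]]]; rewrite inE.
  case/andP=> jk /and4P[kh /forallP iS segQ /(connected_segmentP i kh) uncut].
  have {}iS (a : 'I_n.-1) : (k <= a <= h)%N -> i \in S (An_src a).
    by move=> kah; move: (iS (An_src a)) => /implyP; apply.
  exists h; rewrite // /both_open /edge /cut !at_arrowE iS ?kh ?leqnn //= jS ih /=.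
  have : cut j h || open_left (cut j) (cut i) (edge i j) h.
    have uncut_nat (t : nat) : (k <= t < h)%N -> ~~ cut i t.
      move=> kah; apply/negP=> /at_arrow_true[b bE].
      by apply/negP/uncut; rewrite bE.
    apply: (open_left_intro kh _ _ uncut_nat).
    - by rewrite /cut at_arrowE.
    - by rewrite /edge at_arrowE iS ?kh ?leqnn.
    move=> t /andP[kt th] et ct.
    have tn : (t.+1 < n.-1)%N by rewrite (leq_ltn_trans th).
    apply: (@edge_pred i j (Ordinal tn)) => //.
    by move=> b bE; apply: iS; rewrite bE kt ltnW.
  by rewrite /cut at_arrowE.
have [k kh [pk kE]] : exists2 k, (k <= h)%N & cut j k /\
    forall t, (k <= t < h)%N -> edge i j t && ~~ cut i t.
  case/orP: ph => [ph|/open_left_witness[k kh kP]].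
    by exists h => //; split=> // t /andP[ht]; rewrite ltnNge ht.
  by exists k; first exact: ltnW.
exists h; rewrite inE.
move: qh eh; rewrite /cut /edge !at_arrowE => -> /andP[iSh ->]; rewrite eqxx /=.
have [b bE jb] := at_arrow_true pk; rewrite -bE in kh kE.
have iS (t : 'I_n) : (b <= t <= h)%N -> i \in S t.
  move=> /andP[bt]; rewrite leq_eqVlt => /predU1P[th|th].
    by have -> : t = An_src h by apply: val_inj.
  have /kE/andP[/at_arrow_true[a aE /andP[iSa _]] _] : (b <= t < h)%N by rewrite bt.
  by have -> : t = An_src a by apply: val_inj.
apply/existsP; exists b; rewrite inE jb kh /=; apply/and3P; split.
- by apply/forallP=> t; apply/implyP/iS.
- by apply/subsetP=> x; rewrite !inE => /andP[/eqP-> /iS].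
- apply/connected_segmentP => // a /kE/andP[_].
  by rewrite /cut at_arrowE.
Qed.

End SingPath.

(** * The dimension of Ext^1 *)

Section DimExt.
Variables (F : fieldType) (n : nat) (v : n.+1.-tuple 'rV[F]_n.+1).
Variables (R : 'I_n.-1 -> {set 'I_n.+1}) (S : 'I_n -> {set 'I_n.+1}).
Hypotheses (vB : basis_of fullv v) (adm : admissible R S).
Local Notation M := (rep_sub (MS vB adm)).
Local Notation N := (rep_quo (MS vB adm)).
Local Notation edge_entry x a i j :=
  (@entry F n v (S (An_src a)) (S (An_tgt a)) (x a) i j).
Implicit Types (x y z : cochain M N) (i j : 'I_n.+1) (a : 'I_n.-1).

(** The coefficients at (i, j) of the cochain x, as a function on the edges of
    the path of (i, j); they are set to 0 off these edges. *)
Definition path_entry x i j : nat -> F := at_arrow 0 (fun a =>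
  if (i \in S (An_src a)) && (j \notin S (An_tgt a))
  then edge_entry x a i j else 0).

Lemma path_entryE x i j a : edge S i j a ->
  path_entry x i j a = edge_entry x a i j.
Proof. by rewrite /edge /path_entry !at_arrowE => ->. Qed.

Lemma path_entry_linear c x y z i j (t : nat) :
    (forall a u, z a u = c *: x a u + y a u) ->
  path_entry z i j t = c * path_entry x i j t + path_entry y i j t.
Proof.
move=> zE; rewrite /path_entry /at_arrow; case: insub => [a|]; last first.
  by rewrite mulr0 addr0.
case: ifP => _; last by rewrite mulr0 addr0.
by rewrite /entry zE !linearP.
Qed.

(** The maps of both representations are diagonal in the bases of rows, so the
    differential decouples over the pairs (i, j) into copies of path_diff. *)
Lemma coboundary_entry x (k : forall t, 'Hom(M t, N t)) a i j :
    (forall u, x a u =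
       rep_map N a (k (An_src a) u) - k (An_tgt a) (rep_map M a u)) ->
    edge S i j a ->
  edge_entry x a i j =
    (if j \in R a then 0 else
       @entry F n v (S (An_src a)) (S (An_src a)) (k (An_src a)) i j)
    - (if i \in R a then 0 else
       @entry F n v (S (An_tgt a)) (S (An_tgt a)) (k (An_tgt a)) i j).
Proof.
move=> xE; rewrite /edge at_arrowE => /andP[iS jS].
set u := sub_row v (S (An_src a)) i.
have -> : edge_entry x a i j =
    coord v j (vsval (rep_map N a (k (An_src a) u)))
    - coord v j (vsval (k (An_tgt a) (rep_map M a u))).
  by rewrite /entry xE !linearB.
rewrite coord_quo_map //; congr (_ - _).
have -> := sub_map_row vB adm iS.
by case: ifP => // _; rewrite !linear0.
Qed.

(** One linear functional for each singularity (i, (j, h.+1)): up to sign, the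
    sum of the coefficients at (i, j) over the component that ends with h. *)
Definition Sing_values x : 'rV[F]_#|Sing R S| :=
  \row_(s < #|Sing R S|) let z := enum_val s in
    left_sum (cut R z.2.1) (path_entry x z.1 z.2.1) z.2.2.

Lemma Sing_values_linear c x y z : (forall a u, z a u = c *: x a u + y a u) ->
  Sing_values z = c *: Sing_values x + Sing_values y.
Proof.
move=> zE; apply/rowP=> s; rewrite !mxE -left_sum_linear.
by apply: eq_left_sum => t _; apply: path_entry_linear.
Qed.

Lemma Sing_values_eq0 x : Sing_values x = 0 <-> is_coboundary x.
Proof.
split=> [x0|[k kE]].
  have vanish i j h : both_open (cut R j) (cut R i) (edge S i j) h ->
      left_sum (cut R j) (path_entry x i j) h.+1 = 0.
    move=> bh; have [a aE _] : exists2 a : 'I_n.-1, val a = h & true.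
      by have [/at_arrow_true[a aE _] _] := andP bh; exists a.
    rewrite -aE in bh *.
    have zS : (i, (j, An_tgt a)) \in Sing R S.
      by apply/(Sing_both_open adm); exists a.
    have := congr1 (fun w : 'rV_ _ => w 0 (enum_rank_in zS (i, (j, An_tgt a)))) x0.
    by rewrite !mxE enum_rankK_in.
  pose prim i j (t : nat) := primitive (cut R j) (cut R i) (edge S i j)
    (path_entry x i j) n.-1 t.
  pose k (y : 'I_n) : 'Hom(M y, N y) :=
    of_entries v (S y) (S y) (fun i j => prim i j (val y)).
  exists k => a u.
  pose y : cochain M N := fun b =>
    ((rep_map N b \o k (src b)) - (k (tgt b) \o rep_map M b))%VF.
  have yE w : y a w = rep_map N a (k (An_src a) w) - k (An_tgt a) (rep_map M a w).
    by rewrite add_lfunE opp_lfunE !comp_lfunE.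
  rewrite -yE; apply: (entry_inj vB) => i j iS jS.
  have eij : edge S i j a by rewrite /edge at_arrowE iS.
  rewrite -path_entryE // -(primitiveP (ltn_ord a) eij (vanish i j)).
  rewrite [RHS](coboundary_entry yE eij) /path_diff /cut !at_arrowE.
  congr (_ - _); case: ifP => // Ra.
    rewrite entry_of_entries //; apply: contra jS => /(subsetP (adm.2 a)).
    by rewrite inE Ra orbF.
  rewrite entry_of_entries //.
  by move/(subsetP (adm.2 a)): iS; rewrite inE Ra orbF.
apply/rowP=> s; rewrite !mxE; move: (enum_valP s).
case: (enum_val s) => i [j c] /(Sing_both_open adm)[h -> bh] /=.
pose f (t : nat) := if (insub t : option 'I_n) is Some y
  then @entry F n v (S y) (S y) (k y) i j else 0.
have fE (y : 'I_n) : f y = @entry F n v (S y) (S y) (k y) i j.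
  by rewrite /f valK.
apply: (left_sum_both_open (f := f) _ bh) => t et.
have [a aE _] := at_arrow_true et; rewrite -aE in et *.
rewrite path_entryE // (coboundary_entry (kE a) et) /path_diff /cut !at_arrowE.
by rewrite (fE (An_src a)) (fE (An_tgt a)).
Qed.

Lemma Sing_values_surj w : exists x, Sing_values x = w.
Proof.
(* Minus, because left_sum at the last edge h of a component is minus the sum. *)
pose c i j (a : 'I_n.-1) := - \sum_(s | enum_val s == (i, (j, An_tgt a))) w 0 s.
exists (fun a => of_entries v _ _ (fun i j => c i j a)).
apply/rowP=> s; rewrite mxE; have := enum_valP s.
case sE: (enum_val s) => [i [j z]] /(Sing_both_open adm)[h zE bh].
rewrite /= zE (left_sum_supported _ bh) => [|t nbt].
  have /and3P[eh _ _] := bh.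
  rewrite path_entryE //; move: eh; rewrite /edge at_arrowE => /andP[iS jS].
  rewrite entry_of_entries // opprK (big_pred1 s) // => s'.
  by rewrite /= -zE -sE (inj_eq enum_val_inj).
rewrite /path_entry /at_arrow; case: insubP => // a _ aE.
case: ifP => // /andP[iS jS]; rewrite entry_of_entries // /c big_pred0 ?oppr0 //.
move=> s'; apply/negP=> /eqP s'E; case/negP: nbt.
have /(Sing_both_open adm)[b bE] : (i, (j, An_tgt a)) \in Sing R S.
  by rewrite -s'E enum_valP.
have -> : b = a by apply: val_inj; case: (congr1 val bE).
by rewrite -aE.
Qed.

Lemma dim_Ext1_Sing : dim_Ext1 M N #|Sing R S|.
Proof.
exact: dim_Ext1_cochain Sing_values_linear Sing_values_eq0 Sing_values_surj.
Qed.

End DimExt.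

Theorem proposition5p5 (R : realType) (n : nat) (hn : (0 < n)%N)
    (v : n.+1.-tuple 'rV[R[i]]_n.+1) (hv : basis_of fullv v)
    (RR : 'I_n.-1 -> {set 'I_n.+1}) (S : 'I_n -> {set 'I_n.+1})
    (hS : admissible RR S) :
  dim_Ext1 (rep_sub (MS hv hS)) (rep_quo (MS hv hS)) #|Sing RR S|.
Proof. exact: dim_Ext1_Sing. Qed.
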